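(* Let $n,s\in\mathbb{N}$ and let $p_{X,Y}\in\mathcal{E}[0,1]^2_n$ have weights $w_{k_1,k_2}$ that depend only on $k_2$, i.e. $w_{k_1,k_2}=w_{k_2}$ for all $k_1,k_2\in\{0,\dots,n-1\}$ (where $k_1$ indexes the $x$-coordinate and $k_2$ the $y$-coordinate of the cell). Then there exists a ReLU network $\Phi\in\mathcal{N}_{1,2}$ with connectivity $\mathcal{M}(\Phi)\le 6n+24s+2$ and depth $\mathcal{L}(\Phi)=s+3$ such that \[ W(\Phi\#U,\,p_{X,Y})\le\frac{2\sqrt2}{2^s}. \]
   Context: $\mathcal{E}[0,1]^2_n$: densities $p(x,y)=\sum_{k_1,k_2=0}^{n-1}w_{k_1,k_2}\chi_{[k_1/n,(k_1+1)/n]\times[k_2/n,(k_2+1)/n]}(x,y)$ with all $w_{k_1,k_2}>0$ and $\sum w_{k_1,k_2}=n^2$. A ReLU network of depth $L\ge2$ is $\Phi=W_L\circ\rho\circ W_{L-1}\circ\cdots\circ\rho\circ W_1$ with affine $W_\ell(x)=A_\ell x+b_\ell$ and $\rho(x)=\max(x,0)$ componentwise; $\mathcal{L}(\Phi)=L$; $\mathcal{M}(\Phi)$ is the total number of nonzero entries of all $A_\ell,b_\ell$; $\mathcal{N}_{d,d'}$ is the set of such networks with input dimension $d$, output dimension $d'$. $U$ is uniform on $[0,1]$, $\#$ is push-forward, and $W$ is the 1-Wasserstein distance $W(\mu,\nu)=\inf_\pi\int|x-y|d\pi$ over couplings of $\mu,\nu$ with Euclidean norm. *)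

(* Defs.v *)
From HB Require Import structures.
From mathcomp Require Import all_boot all_order all_algebra.
From mathcomp Require Import all_classical all_reals all_analysis.
Set Implicit Arguments. Unset Strict Implicit. Unset Printing Implicit Defensive.
Import Order.TTheory GRing.Theory Num.Theory.
Import numFieldNormedType.Exports.
Local Open Scope classical_set_scope.
Local Open Scope ring_scope.

Section Defs.
Variable R : realType.

(* ReLU networks: [net m n] has input dimension m and output dimension n.
   [Last A b] is a single (final) affine layer W_L(x) = A x + b;
   [Cons A b N] is x |-> N (rho (A x + b)). *)
Inductive net : nat -> nat -> Type :=
| Last : forall m n, 'M[R]_(n, m) -> 'cV[R]_n -> net m n
| Cons : forall m k n, 'M[R]_(k, m) -> 'cV[R]_k -> net k n -> net m n.

Definition relu_vec k (v : 'cV[R]_k) : 'cV[R]_k := map_mx (fun t => Num.max t 0) v.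

Fixpoint realize m n (N : net m n) : 'cV[R]_m -> 'cV[R]_n :=
  match N in net m n return 'cV[R]_m -> 'cV[R]_n with
  | Last _ _ A b => fun x => A *m x + b
  | Cons _ _ _ A b N' => fun x => realize N' (relu_vec (A *m x + b))
  end.

Fixpoint depth m n (N : net m n) : nat :=
  match N with
  | Last _ _ _ _ => 1
  | Cons _ _ _ _ _ N' => (depth N').+1
  end.

Definition nnz_mx p q (A : 'M[R]_(p, q)) : nat := #|[set ij : 'I_p * 'I_q | A ij.1 ij.2 != 0]|.

Fixpoint connectivity m n (N : net m n) : nat :=
  match N with
  | Last _ _ A b => (nnz_mx A + nnz_mx b)%N
  | Cons _ _ _ A b N' => (nnz_mx A + nnz_mx b + connectivity N')%N
  end.

Definition net12_fun (N : net 1 2) (x : R) : R * R :=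
  let v := realize N (const_mx x) in (v ord0 ord0, v (@Ordinal 2 1 isT) ord0).

Definition pushU (N : net 1 2) (A : set (R * R)) : \bar R :=
  (@lebesgue_measure R) ([set x | 0 <= x <= 1] `&` (net12_fun N @^-1` A)).

Definition cell_density n (w : 'I_n -> 'I_n -> R) (z : R * R) : R :=
  \sum_(k1 < n) \sum_(k2 < n)
     w k1 k2 * (\1_([set x | k1%:R / n%:R <= x <= k1.+1%:R / n%:R]
                    `*` [set y | k2%:R / n%:R <= y <= k2.+1%:R / n%:R]) z).

Definition in_E2 n (w : 'I_n -> 'I_n -> R) : Prop :=
  (forall k1 k2, 0 < w k1 k2) /\ \sum_(k1 < n) \sum_(k2 < n) w k1 k2 = (n ^ 2)%:R.

Definition density_law (p : R * R -> R) (A : set (R * R)) : \bar R :=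
  (\int[(@lebesgue_measure R \x @lebesgue_measure R)%E]_(z in A) (p z)%:E)%E.

Definition eucl_dist (z : (R * R) * (R * R)) : R :=
  Num.sqrt ((z.1.1 - z.2.1) ^+ 2 + (z.1.2 - z.2.2) ^+ 2).

Definition coupling (mu nu : set (R * R) -> \bar R)
    (pi : probability ((R * R) * (R * R))%type R) : Prop :=
  forall A : set (R * R), measurable A ->
    pi (fst @^-1` A) = mu A /\ pi (snd @^-1` A) = nu A.

Definition W1 (mu nu : set (R * R) -> \bar R) : \bar R :=
  ereal_inf [set c | exists pi, coupling mu nu pi /\
                     c = (\int[pi]_z (eucl_dist z)%:E)%E].

End Defs.

(* Main.v *)
Require Import Defs.
From HB Require Import structures.
From mathcomp Require Import all_boot all_order all_algebra.
From mathcomp Require Import all_classical all_reals all_analysis.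
From mathcomp Require Import measurable_realfun.
From mathcomp Require Import ring lra zify.
Set Implicit Arguments. Unset Strict Implicit. Unset Printing Implicit Defensive.
Import Order.TTheory GRing.Theory Num.Theory.
Local Open Scope classical_set_scope.
Local Open Scope ring_scope.

(** The density depends on [y] only, so its law is the image of the uniform law
    on the unit square under [(x, t) |-> (x, Q t)], where [Q] is the quantile
    function of the second marginal; [Q] is piecewise affine with [n] pieces,
    hence one ReLU layer. The network computes [x |-> (x, Q (g x))] for the
    [s]-fold iterate [g] of the tent map, which sends each of the [2 ^ s] dyadic
    cells onto the unit interval. For [(x, t)] in the square let [b (x, t)] be
    the point of the cell of [x] that [g] sends to [t]. If [(x, t)] is uniform
    then so is [b (x, t)], so that [((b (x, t), Q t), (x, Q t))] is a coupling
    of the two laws, and its components are at distance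
    [|b (x, t) - x| <= 2 ^- s]. *)

(** * The network *)

(** On [0, 1] two ReLUs suffice: slope 2 up to 1/2, slope -2 after it. *)
Definition tent (R : realType) (t : R) : R :=
  2 * Num.max t 0 - 4 * Num.max (t - 2^-1) 0.

(** The value at k / n of the distribution function of the density equal to [v j] on the j-th cell,
    hence a breakpoint of the quantile function. *)
Definition knot (R : realType) n (v : nat -> R) k : R := (\sum_(j < k) v j) / n%:R.

Definition slope_jump (R : realType) (v : nat -> R) i : R :=
  if i is j.+1 then (v i)^-1 - (v j)^-1 else (v 0%N)^-1.

(* Restricted to [0, 1] and with [m = n], this is the quantile function of the
   density equal to [v k] on the [k]-th cell, written as a sum of ReLUs. *)
Definition quantile (R : realType) n (v : nat -> R) m (t : R) : R :=
  \sum_(i < m) slope_jump v i * Num.max (t - knot n v i) 0.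

Definition mx_of_rows (R : realType) p q (r : seq (seq R)) : 'M[R]_(p, q) :=
  \matrix_(i, j) nth 0 (nth [::] r i) j.

Lemma nnz_mxE (R : realType) p q (A : 'M[R]_(p, q)) :
  nnz_mx A = (\sum_i \sum_j (A i j != 0%R))%N.
Proof.
rewrite /nnz_mx -sum1_card pair_big/= big_mkcond/=; apply: eq_bigr => -[i j] _.
by rewrite unfold_in /= /in_set asboolb; case: (_ != 0).
Qed.

Lemma leq_sum_ord_const n k (F : 'I_n -> nat) :
  (forall i, F i <= k)%N -> (\sum_i F i <= n * k)%N.
Proof.
move=> Fk; apply: (@leq_trans (\sum_(i < n) k)); first exact: leq_sum.
by rewrite sum_nat_const card_ord.
Qed.

Lemma leq_nnz_col (R : realType) p (b : 'cV[R]_p.+1) :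
  b ord0 ord0 = 0 -> (nnz_mx b <= p)%N.
Proof.
move=> b0; rewrite nnz_mxE big_ord_recl big_ord1 b0 eqxx add0n.
rewrite -[leqRHS]muln1; apply: leq_sum_ord_const => i; by rewrite big_ord1; case: (_ != 0).
Qed.

(** The first row carries x, which ReLU fixes when x >= 0. The other two rows both read off the
    encoded number; the bias shifts one of them by - 1/2, which yields the two ReLUs of [tent]. This
    costs 1 + 2 + 2 + 1 = 6 nonzero entries. *)
Definition tent_mx (R : realType) : 'M[R]_3 :=
  mx_of_rows 3 3 [:: [:: 1; 0; 0]; [:: 0; 2; -4]; [:: 0; 2; -4]].
Definition tent_bias (R : realType) : 'cV[R]_3 :=
  mx_of_rows 3 1 [:: [:: 0]; [:: 0]; [:: - 2^-1]].

(* A hidden vector (x, b, c) of these layers encodes the pair (x, 2 b - 4 c). *)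
Definition decode (R : realType) (u : 'cV[R]_3) : R :=
  2 * u (inord 1) ord0 - 4 * u (inord 2) ord0.

Fixpoint tent_layers (R : realType) k s (N : net R 3 k) : net R 3 k :=
  if s is s'.+1 then Defs.Cons (tent_mx R) (tent_bias R) (tent_layers s' N) else N.

Lemma inord31 : @inord 2 1 = lift ord0 ord0.
Proof. by apply/val_inj; rewrite /= inordK. Qed.

Lemma inord32 : @inord 2 2 = lift ord0 (lift ord0 ord0).
Proof. by apply/val_inj; rewrite /= inordK. Qed.

Lemma decodeE (R : realType) (u : 'cV[R]_3) :
  decode u = 2 * u (lift ord0 ord0) ord0 - 4 * u (lift ord0 (lift ord0 ord0)) ord0.
Proof. by rewrite /decode inord31 inord32. Qed.

(** Each layer applies [tent] to the decoded number. The vector [u'] is left existential because the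
    knot layer reads only its first entry and its decoded value. *)
Lemma realize_tent_layers (R : realType) k s (N : net R 3 k) (u : 'cV[R]_3) :
  0 <= u ord0 ord0 ->
  exists u' : 'cV[R]_3, [/\ realize (tent_layers s N) u = realize N u',
    u' ord0 ord0 = u ord0 ord0 & decode u' = iter s (@tent R) (decode u)].
Proof.
elim: s u => [|s IH] u u0; first by exists u.
rewrite [realize _ _]/=.
set u1 := relu_vec _.
have E0 : u1 ord0 ord0 = u ord0 ord0.
  by rewrite !mxE !big_ord_recl big_ord0 !mxE /= mul1r !mul0r !addr0 max_l.
have E1 : decode u1 = tent (decode u).
  rewrite !decodeE !mxE !big_ord_recl !big_ord0 !mxE /= /tent.
  by rewrite !mul0r !add0r !addr0 !mulNr.
have [|u' [Eu' E0' E1']] := IH u1; first by rewrite E0.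
by exists u'; rewrite Eu' E0' E1' E1 E0 -iterSr.
Qed.

Lemma tent_layers_depth (R : realType) k s (N : net R 3 k) :
  depth (tent_layers s N) = (s + depth N)%N.
Proof. by elim: s => //= s ->. Qed.

Lemma tent_layers_connectivity (R : realType) k s (N : net R 3 k) :
  (connectivity (tent_layers s N) <= 6 * s + connectivity N)%N.
Proof.
elim: s => [//|s IH] /=.
suff : (nnz_mx (tent_mx R) + nnz_mx (tent_bias R) <= 6)%N by lia.
rewrite !nnz_mxE !big_ord_recl !big_ord0 !mxE /= eqxx.
by do !case: (_ != 0).
Qed.

(** The entry 1/2 makes the loaded vector decode to x, the starting point of the iteration. *)
Definition load_mx (R : realType) : 'M[R]_(3, 1) :=
  mx_of_rows 3 1 [:: [:: 1]; [:: 2^-1]; [:: 0]].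

Definition knot_mx (R : realType) n : 'M[R]_(n.+1, 3) :=
  \matrix_(i, j) if unlift ord0 i is Some _ then nth 0 [:: 0; 2; -4] j
                 else nth 0 [:: 1; 0; 0] j.

Definition knot_bias (R : realType) n (v : nat -> R) : 'cV[R]_n.+1 :=
  \matrix_(i, j) if unlift ord0 i is Some k then - knot n v k else 0.

Definition out_mx (R : realType) n (v : nat -> R) : 'M[R]_(2, n.+1) :=
  \matrix_(i, j) if unlift ord0 j is Some k then
    (if unlift ord0 i is Some _ then slope_jump v k else 0)
    else (if unlift ord0 i is Some _ then 0 else 1).

Definition curve_net (R : realType) n s (v : nat -> R) : net R 1 2 :=
  Defs.Cons (load_mx R) 0
    (tent_layers s (Defs.Cons (knot_mx R n) (knot_bias n v) (Last (out_mx n v) 0))).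

Lemma curve_net_depth (R : realType) n s (v : nat -> R) :
  depth (curve_net n s v) = (s + 3)%N.
Proof. by rewrite /= tent_layers_depth /=; lia. Qed.

Lemma nnz_mx0 (R : realType) p q : nnz_mx (0 : 'M[R]_(p, q)) = 0%N.
Proof. by rewrite nnz_mxE big1// => i _; rewrite big1// => j _; rewrite mxE eqxx. Qed.

Lemma curve_net_connectivity (R : realType) n s (v : nat -> R) : (0 < n)%N ->
  (connectivity (curve_net n s v) <= 6 * n + 24 * s + 2)%N.
Proof.
move=> n0 /=; rewrite !nnz_mx0 !addn0.
set N := Defs.Cons _ _ _.
have H1 : (nnz_mx (load_mx R) <= 2)%N.
  rewrite !nnz_mxE !big_ord_recl !big_ord0 !mxE /= eqxx.
  by do !case: (_ != 0).
have H2 : (nnz_mx (knot_bias n v) <= n)%N.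
  by apply: leq_nnz_col; rewrite mxE unlift_none.
have H3 : (nnz_mx (knot_mx R n) <= 1 + n * 2)%N.
  rewrite nnz_mxE big_ord_recl leq_add//.
    rewrite !big_ord_recl !big_ord0 !mxE unlift_none /= eqxx.
    by do !case: (_ != 0).
  apply: leq_sum_ord_const => i; rewrite !big_ord_recl !big_ord0 !mxE liftK /= eqxx.
  by do !case: (_ != 0).
have H4 : (nnz_mx (out_mx n v) <= 1 + n)%N.
  rewrite nnz_mxE !big_ord_recl big_ord0 /= addn0.
  rewrite !mxE !unlift_none liftK eqxx big1 ?addn0; last first.
    by move=> i _; rewrite mxE unlift_none liftK eqxx.
  rewrite add0n leq_add//; first by case: (_ != 0).
  by rewrite -[leqRHS]muln1; apply: leq_sum_ord_const => i; case: (_ != 0).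
have /= := tent_layers_connectivity s N.
(* The total is at most 2 + 6 s + (1 + 2 n) + n + (1 + n) = 4 n + 6 s + 4, which is within the bound
   since n >= 1. *)
rewrite nnz_mx0 => H5; lia.
Qed.

Lemma net12_fun_curve_net (R : realType) n s (v : nat -> R) (x : R) : 0 <= x ->
  net12_fun (curve_net n s v) x = (x, quantile n v n (iter s (@tent R) x)).
Proof.
move=> x0; rewrite /net12_fun /=; set u := relu_vec _.
have E0 : u ord0 ord0 = x.
  by rewrite !mxE big_ord1 !mxE /= mul1r addr0 max_l.
have E1 : decode u = x.
  rewrite decodeE !mxE !big_ord1 !mxE /= mul0r !addr0 max_l; last lra.
  by rewrite maxxx; lra.
set N := Defs.Cons _ _ _.
have [|u' [-> u'0 u'1]] := @realize_tent_layers R 2 s N u; first by rewrite E0.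
rewrite E1 in u'1; rewrite E0 in u'0.
congr pair => /=.
- rewrite !mxE big_ord_recl big1 => [|i _]; last first.
    by rewrite mxE unlift_none liftK mul0r.
  rewrite !mxE !unlift_none !big_ord_recl big_ord0 !mxE !unlift_none /=.
  by rewrite !mul0r !addr0 !mul1r u'0 max_l.
- have -> : (Ordinal (isT : (1 < 2)%N)) = lift ord0 ord0 by apply/val_inj.
  rewrite !mxE big_ord_recl !mxE unlift_none liftK mul0r add0r addr0.
  rewrite /quantile; apply: eq_bigr => i _.
  rewrite !mxE !liftK !big_ord_recl big_ord0 !mxE liftK /=.
  by rewrite mul0r add0r addr0 mulNr -decodeE u'1.
Qed.

(** * Affine change of variables *)

Local Notation mu1 := (@lebesgue_measure _).
Local Notation mu2 := (@lebesgue_measure _ \x @lebesgue_measure _)%E.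

Definition affine (R : realType) (a b x : R) : R := a * x + b.

Lemma measurable_affine (R : realType) (a b : R) :
  measurable_fun setT (affine a b : measurableTypeR R -> measurableTypeR R).
Proof. by apply: measurable_funD => //. Qed.

(** By uniqueness of Lebesgue measure it is enough to compare both sides on half-open intervals. *)
Lemma lebesgue_affine_preimage (R : realType) (a b : R) (A : set (measurableTypeR R)) :
  a != 0 -> measurable A ->
  lebesgue_measure A = (`|a|%:E * lebesgue_measure (affine a b @^-1` A))%E.
Proof.
move=> a0 mA; have na0 : 0 <= `|a| by [].
have mf := @measurable_affine R a b.
pose m : {measure set (measurableTypeR R) -> \bar R} :=
  mscale (NngNum na0) (pushforward (@lebesgue_measure R) (affine a b : measurableTypeR R -> measurableTypeR R)).
have -> := @lebesgue_measure_unique R (m mf) _ A mA; first by [].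
move=> _ [[c d] _ <-] /=; rewrite /m /= /mscale /= /pushforward.
rewrite lebesgue_measure_itv/=.
have [an|ap|/eqP] := ltgtP a 0; last by rewrite (negbTE a0).
(* A negative slope swaps the endpoints, so the preimage is closed on the left instead. *)
- have -> : affine a b @^-1` `]c, d] = `[(d - b) / a, (c - b) / a[%classic.
    apply/seteqP; split => x /=; rewrite !in_itv /affine /= => /andP[h1 h2];
    apply/andP; move: h1 h2.
      by rewrite ler_ndivrMr// ltr_ndivlMr// => h1 h2; lra.
    by rewrite ler_ndivrMr// ltr_ndivlMr// => h1 h2; lra.
  rewrite lebesgue_measure_itv/= !lte_fin ltr_ndivrMr// divfK//.
  rewrite ltrD2r.
  case: ifP => _; last by rewrite mule0.
  rewrite -!EFinB -EFinM; congr EFin; rewrite ltr0_norm//; field; exact: a0.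
- have -> : affine a b @^-1` `]c, d] = `](c - b) / a, (d - b) / a]%classic.
    apply/seteqP; split => x /=; rewrite !in_itv /affine /= => /andP[h1 h2];
    apply/andP; move: h1 h2.
      by rewrite ler_pdivlMr// ltr_pdivrMr// => h1 h2; lra.
    by rewrite ler_pdivlMr// ltr_pdivrMr// => h1 h2; lra.
  rewrite lebesgue_measure_itv/= !lte_fin ltr_pdivrMr// divfK//.
  rewrite ltrD2r.
  case: ifP => _; last by rewrite mule0.
  rewrite -!EFinB -EFinM; congr EFin; rewrite gtr0_norm//; field; exact: a0.
Qed.

Definition affine2 (R : realType) (a b c d : R) (z : R * R) : R * R :=
  (affine a b z.1, affine c d z.2).

Lemma measurable_affine2 (R : realType) (a b c d : R) :
  measurable_fun setT (affine2 a b c d : measurableTypeR R * measurableTypeR R -> measurableTypeR R * measurableTypeR R).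
Proof.
by apply: measurable_fun_pair; (apply: measurableT_comp; first exact: measurable_affine).
Qed.

(** The map acts coordinatewise, so the one-dimensional rule settles rectangles, and these determine
    the product measure. *)
Lemma lebesgue2_affine_preimage (R : realType) (a b c d : R)
    (A : set (R * R)) :
  a != 0 -> c != 0 -> measurable A ->
  mu2 A = (`|a * c|%:E * mu2 (affine2 a b c d @^-1` A))%E.
Proof.
move=> a0 c0 mA; have na0 : 0 <= `|a * c| by [].
have mf := @measurable_affine2 R a b c d.
pose m : {measure set (measurableTypeR R * measurableTypeR R) -> \bar R} :=
  mscale (NngNum na0) (pushforward mu2 (affine2 a b c d : measurableTypeR R * measurableTypeR R -> measurableTypeR R * measurableTypeR R)).
have -> := @product_measure_unique _ _ _ _ R mu1 mu1 (m mf) _ A mA; first by [].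
move=> B C mB mC; rewrite /m /= /mscale /= /pushforward.
have -> : affine2 a b c d @^-1` (B `*` C) = (affine a b @^-1` B) `*` (affine c d @^-1` C) by [].
rewrite product_measure1E; last 2 first.
- by rewrite -[X in measurable X]setTI; exact: measurable_affine.
- by rewrite -[X in measurable X]setTI; exact: measurable_affine.
rewrite (lebesgue_affine_preimage b a0 mB) (lebesgue_affine_preimage d c0 mC).
by rewrite muleACA -EFinM normrM.
Qed.

(** * Slices, quantiles and branches of the iterated tent map *)

Lemma measure_eq_off_null d (T : measurableType d) (R : realType)
    (mu : {measure set T -> \bar R}) (N A B : set T) :
  measurable N -> measurable A -> measurable B -> mu N = 0%E ->
  A `\` N = B `\` N -> mu A = mu B.
Proof.
move=> mN mA mB N0 AB.
have H C : measurable C -> mu C = mu (C `\` N).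
  move=> mC; have CN0 : mu (C `&` N) = 0%E.
    by apply: (subset_measure0 _ mN) => //; exact: measurableI.
  by rewrite [LHS](measureDI mu mC mN) [X in (_ + X)%E]CN0 adde0.
by rewrite (H A)// AB -H.
Qed.

Lemma measureU_null d (T : measurableType d) (R : realType)
    (mu : {measure set T -> \bar R}) (A B : set T) :
  measurable A -> measurable B -> mu (A `&` B) = 0%E ->
  mu (A `|` B) = (mu A + mu B)%E.
Proof.
move=> mA mB AB0.
have mBA : measurable (B `\` A) by exact: measurableD.
have -> : A `|` B = A `|` (B `\` A) by rewrite setUDr setDv setD0.
rewrite measureU//; last by rewrite setDE setICA setICr setI0.
by rewrite [in RHS](measureDI mu mB mA) setIC [X in (_ + (_ + X))%E]AB0 adde0.
Qed.

(** Consecutive closed slices meet inside a level set of [g], which is null, so overlaps do not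
    count. *)
Lemma sum_measure_slices d (T : measurableType d) (R : realType)
    (mu : {measure set T -> \bar R}) (g : T -> R) (c : nat -> R) m (A : set T) :
  measurable A -> measurable_fun setT g ->
  (forall r, mu (g @^-1` [set r]) = 0%E) -> (forall k, c k <= c k.+1) ->
  (\sum_(k < m) mu (A `&` g @^-1` `[c k, c k.+1]) = mu (A `&` g @^-1` `[c 0%N, c m]))%E.
Proof.
move=> mA mg g0 cS.
have mpre (D : set R) : measurable D -> measurable (g @^-1` D).
  by move=> mD; rewrite -[X in measurable X]setTI; exact: mg.
have c0 k : c 0%N <= c k by elim: k => // k; move/le_trans; apply.
elim: m => [|m IH].
  (* With no slices, the right-hand side is the measure of part of a single level set. *)
  rewrite big_ord0; apply/esym; apply: (subset_measure0 _ (mpre [set c 0%N] _) _ (g0 _)) => //.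
    by apply: measurableI => //; exact: mpre.
  by move=> z [_ /=]; rewrite in_itv/= => /andP[h1 h2]; apply/le_anti/andP.
rewrite big_ord_recr /= IH -measureU_null; last 3 first.
- by apply: measurableI => //; exact: mpre.
- by apply: measurableI => //; exact: mpre.
- apply: (subset_measure0 _ (mpre [set c m] _) _ (g0 _)) => //.
    by apply: measurableI; apply: measurableI => //; exact: mpre.
  move=> z [[_ /=]]; rewrite !in_itv/= => /andP[_ h1] [_ /andP[h2 _]].
  by apply/le_anti/andP.
rewrite -setIUr -preimage_setU; congr (mu (_ `&` (g @^-1` _))).
apply/seteqP; split => r /=; rewrite !in_itv/=.
  case=> /andP[h1 h2]; apply/andP; split => //; first exact: le_trans (cS m).
  exact: le_trans (c0 m) h1.
move=> /andP[h1 h2]; case: (leP r (c m)) => h; [left|right].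
  by rewrite h1.
by rewrite ltW.
Qed.

Lemma lebesgue2_fst_level (R : realType) (r : R) :
  mu2 (fst @^-1` [set r]) = 0%E.
Proof.
have -> : fst @^-1` [set r] = [set r] `*` [set: R].
  by apply/seteqP; split => z //= [].
by rewrite product_measure1E// [X in (X * _)%E]lebesgue_measure_set1 mul0e.
Qed.

Lemma lebesgue2_snd_level (R : realType) (r : R) :
  mu2 (snd @^-1` [set r]) = 0%E.
Proof.
have -> : snd @^-1` [set r] = [set: R] `*` [set r].
  by apply/seteqP; split => z //= [].
by rewrite product_measure1E// [X in (_ * X)%E]lebesgue_measure_set1 mule0.
Qed.

Section knots.
Variables (R : realType) (n : nat) (v : nat -> R).
Hypotheses (n0 : (0 < n)%N) (v0 : forall k, 0 < v k).

Lemma knotS k : knot n v k.+1 = knot n v k + v k / n%:R.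
Proof. by rewrite /knot big_ord_recr mulrDl. Qed.

Lemma knot0 : knot n v 0 = 0.
Proof. by rewrite /knot big_ord0 mul0r. Qed.

Lemma knot_leS k : knot n v k <= knot n v k.+1.
Proof. by rewrite knotS lerDl divr_ge0// ltW. Qed.

Lemma knot_le i j : (i <= j)%N -> knot n v i <= knot n v j.
Proof.
move=> /subnK <-; elim: (j - i)%N => // k /le_trans; apply.
by rewrite addSn knot_leS.
Qed.

(** Right of the m-th knot the first m + 1 ReLUs are all active and their slope jumps telescope to 1
    / [v m]. Each earlier piece j has width [v j] / n and slope 1 / [v j], so it contributes a rise
    of 1 / n. *)
Lemma quantile_last m t : knot n v m <= t ->
  quantile n v m.+1 t = m%:R / n%:R + (t - knot n v m) / v m.
Proof.
have nN0 : n%:R != 0 :> R by rewrite pnatr_eq0 -lt0n.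
elim: m => [|m IH] tm.
  rewrite /quantile big_ord_recr big_ord0 /= add0r max_l; last by rewrite subr_ge0.
  by rewrite mul0r add0r mulrC.
rewrite /quantile big_ord_recr -/(quantile n v m.+1 t) /= IH; last first.
  exact: le_trans (knot_leS m) tm.
rewrite max_l ?subr_ge0// knotS -natr1.
have vN0 k : v k != 0 by rewrite gt_eqF.
by field; rewrite ?vN0 ?nN0.
Qed.

Lemma quantile_on_piece k t : (k < n)%N -> knot n v k <= t <= knot n v k.+1 ->
  quantile n v n t = k%:R / n%:R + (t - knot n v k) / v k.
Proof.
move=> kn /andP[kt tk].
(* The remaining summands have knots at or to the right of [t], so their ReLUs vanish; they are
   added one at a time. *)
rewrite -(quantile_last kt) -[X in quantile n v X](subnKC kn).
elim: (n - k.+1)%N => [|m IH]; first by rewrite addn0.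
rewrite -IH addnS [LHS]/quantile big_ord_recr /= max_r ?mulr0 ?addr0//.
by rewrite subr_le0 (le_trans tk)// knot_le// leq_addr.
Qed.

Lemma measurable_quantile m : measurable_fun setT (quantile n v m).
Proof.
rewrite /quantile; apply: measurable_sum => i.
apply: measurable_funM => //; apply: measurable_maxr => //.
by apply: measurable_funD.
Qed.

End knots.

(* The preimage of [t] under the [s]-th iterate of [tent] that lies in the
   dyadic cell of length [2 ^- s] containing [x]. *)
Fixpoint tent_branch (R : realType) s (x t : R) : R :=
  if s is s'.+1 then
    if x <= 2^-1 then 2^-1 * tent_branch s' (2 * x) t
    else 1 - 2^-1 * tent_branch s' (2 - 2 * x) t
  else t.

Section tent_branch_pointwise.
Variable R : realType.
Implicit Types (s : nat) (x y t : R).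

Lemma tent_branch_itv s x t : 0 <= x <= 1 -> 0 <= t <= 1 -> 0 <= tent_branch s x t <= 1.
Proof.
move=> x01 t01; elim: s x x01 => //= s IH x x01; case: ifPn; rewrite -?ltNge => xh.
  by have := IH (2 * x); lra.
by have := IH (2 - 2 * x); lra.
Qed.

Lemma tent_low y : 0 <= y <= 1 -> tent (2^-1 * y) = y.
Proof. by move=> y01; rewrite /tent max_l ?max_r; lra. Qed.

Lemma tent_high y : 0 <= y <= 1 -> tent (1 - 2^-1 * y) = y.
Proof. by move=> y01; rewrite /tent !max_l; lra. Qed.

Lemma iter_tent_branch s x t : 0 <= x <= 1 -> 0 <= t <= 1 ->
  iter s (@tent R) (tent_branch s x t) = t.
Proof.
(* The first application of [tent] undoes the outermost halving of the branch. *)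
move=> x01 t01; elim: s x x01 => // s IH x x01; rewrite iterSr /=.
case: ifPn; rewrite -?ltNge => xh.
  by rewrite tent_low ?IH// ?tent_branch_itv//; lra.
by rewrite tent_high ?IH// ?tent_branch_itv//; lra.
Qed.

(** The point x is recovered from 2 x or 2 - 2 x by the same contraction as the branch, so each
    level halves the distance. *)
Lemma tent_branch_close s x t : 0 <= x <= 1 -> 0 <= t <= 1 ->
  `|tent_branch s x t - x| <= (2 ^+ s)^-1.
Proof.
move=> x01 t01; elim: s x x01 => [|s IH] x x01 /=.
  by rewrite expr0 invr1 ler_norml; lra.
rewrite exprS invfM; case: ifPn; rewrite -?ltNge => xh.
  have := IH (2 * x); rewrite !ler_norml => H.
  by have := H ltac:(lra); lra.
have := IH (2 - 2 * x); rewrite !ler_norml => H.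
by have := H ltac:(lra); lra.
Qed.

End tent_branch_pointwise.

(** * The law of a random branch *)

Lemma measurable_preimage d d' (T : measurableType d) (U : measurableType d')
    (f : T -> U) (A : set U) :
  measurable_fun setT f -> measurable A -> measurable (f @^-1` A).
Proof. by move=> mf mA; rewrite -[X in measurable X]setTI; exact: mf. Qed.

Definition unit_square (R : realType) : set (R * R) := `[0, 1] `*` `[0, 1].

Lemma measurable_unit_square (R : realType) : measurable (@unit_square R).
Proof. exact: measurableX. Qed.

Lemma unit_squareP (R : realType) (z : R * R) :
  unit_square z <-> (0 <= z.1 <= 1) /\ (0 <= z.2 <= 1).
Proof. by rewrite /unit_square /= !in_itv. Qed.

Lemma measurable_tent_branch (R : realType) s :
  measurable_fun setT (fun z : R * R => tent_branch s z.1 z.2).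
Proof.
elim: s => [|s IH] /=; first exact: measurable_snd.
apply: measurable_fun_ifT.
- exact: measurable_fun_ler.
- apply: measurable_funM => //.
  have := measurableT_comp IH (measurable_affine2 2 0 1 0).
  by apply: eq_measurable_fun => z _; rewrite /= /affine addr0 mul1r addr0.
- apply: measurable_funB => //.
  apply: measurable_funM => //.
  have := measurableT_comp IH (measurable_affine2 (-2) 2 1 0).
  by apply: eq_measurable_fun => z _; rewrite /= /affine mul1r addr0 mulNr addrC.
Qed.

(** Induction on [s]: stretching either half of the square onto the whole square turns the branch of
    order s + 1 into an affine image of that of order s. The factor 1/2 lost in x equals the factor
    lost by shrinking [0, 1] to a half. *)
Lemma tent_branch_uniform (R : realType) s (B : set R) : measurable B ->
  mu2 (@unit_square R `&` (fun z => tent_branch s z.1 z.2) @^-1` B)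
  = mu1 (B `&` `[0, 1]).
Proof.
have mQ := @measurable_unit_square R.
elim: s B => [|s IH] B mB.
  rewrite (_ : _ `&` _ = `[0, 1] `*` (B `&` `[0, 1])); last first.
    by rewrite /unit_square; apply/seteqP; split => -[x t] /= => [[[]]|[? []]].
  rewrite product_measure1E//; last exact: measurableI.
  rewrite [X in (X * _)%E]lebesgue_measure_itv /= lte_fin ltr01 -EFinB subr0.
  by rewrite mul1e.
pose f k (z : R * R) := tent_branch k z.1 z.2.
pose E := unit_square (R := R) `&` f s.+1 @^-1` B.
have mE : measurable E.
  by apply: measurableI => //; apply: measurable_preimage mB; exact: measurable_tent_branch.
pose c (k : nat) : R := k%:R / 2.
have cS k : c k <= c k.+1 by rewrite /c ler_wpM2r ?ler_nat// invr_ge0.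
(* Here x |-> a x + b stretches one half onto [0, 1] and [affine a^-1 (- (b / a))] is its inverse;
   [G] and [H] are the slices of [E] and [B] over that half, and [N] is a null set on which the
   branch formula may fail. *)
have half (a b : R) (H : set R) (N : set (R * R)) (G : set (R * R)) :
    `|a| = 2 -> measurable H -> measurable G -> measurable N -> mu2 N = 0%E ->
    affine a^-1 (- (b / a)) @^-1` H =
      affine a^-1 (- (b / a)) @^-1` B `&` `[0, 1] ->
    G `\` N = affine2 a b 1 0 @^-1` (unit_square (R := R) `&`
      f s @^-1` (affine a^-1 (- (b / a)) @^-1` B)) `\` N ->
    mu2 G = mu1 H.
  move=> a2 mH mG mN N0 HB GN.
  have a0 : a != 0 by rewrite -normr_eq0 a2.
  set B' := affine a^-1 (- (b / a)) @^-1` B in HB GN *.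
  have mB' : measurable B' by apply: measurable_preimage mB; exact: measurable_affine.
  have mP : measurable (unit_square (R := R) `&` f s @^-1` B').
    by apply: measurableI => //; apply: measurable_preimage mB'; exact: measurable_tent_branch.
  rewrite (@measure_eq_off_null _ (measurableTypeR R * measurableTypeR R)%type R mu2 _ _ _ mN mG _ N0 GN); last first.
    apply: measurable_preimage mP; exact: measurable_affine2.
  have := lebesgue2_affine_preimage b 0 a0 (oner_neq0 R) mP.
  rewrite (lebesgue_affine_preimage (a := a^-1) (- (b / a)) _ mH) ?invr_eq0//.
  rewrite HB -(IH B' mB') mulr1 => ->.
  by rewrite muleA -EFinM -normrM mulVf// normr1 mul1e.
have slice k : (k < 2)%N ->
    mu2 (E `&` fst @^-1` `[c k, c k.+1]) = mu1 (B `&` `[c k, c k.+1]).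
  case: k => [|[|//]] _.
  (* The test [x <= 2^-1] includes the endpoint, so the left half has no exceptional points. *)
  - apply: (half 2 0 _ set0).
    + by rewrite ger0_norm.
    + exact: measurableI.
    + by apply: measurableI => //; exact: measurable_preimage.
    + exact: measurable0.
    + exact: measure0.
    + apply/seteqP; split => x /=; rewrite /affine /c !in_itv /=.
        by case=> h1 h2; split => //; lra.
      by case=> h1 h2; split => //; lra.
    + congr (_ `\` _); apply/seteqP; split => -[x t]; rewrite /E /f /affine2 /= !in_itv /= /affine /c.
        case=> -[/unit_squareP/= [x1 t1]] h h2; split.
          by apply/unit_squareP => /=; lra.
        have xh : x <= 2^-1 by lra.
        by rewrite xh in h; rewrite mul0r oppr0 !addr0 mul1r.
      case=> /unit_squareP/= [x1 t1] h2; split; last by lra.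
      have xh : x <= 2^-1 by lra.
      split; first by apply/unit_squareP => /=; lra.
      by rewrite xh; rewrite mul0r oppr0 !addr0 mul1r in h2.
  (* On the line x = 1/2 the branch follows the left formula, so this null line is removed from the
     right half. *)
  - apply: (half (-2) 2 _ (fst @^-1` [set 2^-1])).
    + by rewrite normrN ger0_norm.
    + exact: measurableI.
    + by apply: measurableI => //; exact: measurable_preimage.
    + exact: measurable_preimage.
    + exact: lebesgue2_fst_level.
    + apply/seteqP; split => x /=; rewrite /affine /c !in_itv /=.
        by case=> h1 h2; split => //; lra.
      by case=> h1 h2; split => //; lra.
    + have aE : - (2 / - 2) = 1 :> R by rewrite invrN mulrN opprK divff.
      apply/seteqP; split => -[x t]; rewrite /E /f /affine2 /= !in_itv /= /affine /c aE.
        case=> -[[/unit_squareP/= [x1 t1]]] h h2 xN; split => //; split.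
          by apply/unit_squareP => /=; lra.
        have xh : (x <= 2^-1) = false.
          by apply/negbTE/negP => xh; apply: xN; lra.
        rewrite xh in h; rewrite addr0 mul1r invrN mulNr addrC.
        by rewrite mulNr [- _ + _]addrC.
      case=> -[/unit_squareP/= [x1 t1] h2] xN; split => //; split; last by lra.
      have xh : (x <= 2^-1) = false.
        by apply/negbTE/negP => xh; apply: xN; lra.
      split; first by apply/unit_squareP => /=; lra.
      rewrite xh; rewrite addr0 mul1r invrN mulNr addrC in h2.
      by rewrite mulNr [- _ + _]addrC in h2.
have c0 : c 0%N = 0 by rewrite /c mul0r.
have c2 : c 2%N = 1 by rewrite /c divff.
have := sum_measure_slices (T := (measurableTypeR R * measurableTypeR R)%type) (mu := mu2) 2 mE measurable_fst (@lebesgue2_fst_level R) cS.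
have := sum_measure_slices (T := measurableTypeR R) (mu := @lebesgue_measure R) 2 mB (@measurable_id _ _ setT) (@lebesgue_measure_set1 R) cS.
rewrite c0 c2 => <-.
have -> : E `&` fst @^-1` `[0, 1] = E.
  by apply/setIidPl => z [[]].
by move=> <-; apply: eq_bigr => k _; exact: slice.
Qed.

(** * The law of the density *)

(** Cells are written as [fst]-slices of [snd]-slices so that [sum_measure_slices] can later merge
    those with the same [k2]. *)
Lemma density_lawE (R : realType) n (w : 'I_n -> 'I_n -> R) (A : set (R * R)) :
  (forall k1 k2, 0 < w k1 k2) -> measurable A ->
  (density_law (cell_density w) A = \sum_(k1 < n) \sum_(k2 < n) (w k1 k2)%:E *
     mu2 (A `&` snd @^-1` `[(k2%:R / n%:R)%R, (k2.+1%:R / n%:R)%R]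
            `&` fst @^-1` `[(k1%:R / n%:R)%R, (k1.+1%:R / n%:R)%R]))%E.
Proof.
move=> w0 mA; rewrite /density_law /cell_density.
pose I (k : nat) : set (measurableTypeR R) := [set x | k%:R / n%:R <= x <= k.+1%:R / n%:R].
have IE (k : nat) : I k = `[k%:R / n%:R, k.+1%:R / n%:R]%classic.
  by apply/seteqP; split => x; rewrite /I /= in_itv.
have mI k : measurable (I k) by rewrite IE.
have mC k1 k2 : measurable (I k1 `*` I k2) by exact: measurableX.
have mindic k1 k2 : measurable_fun A (fun z => (w k1 k2 * \1_(I k1 `*` I k2) z)%:E).
  by apply/measurable_EFinP; apply: measurable_funM => //; apply: measurable_indic; exact: mC.
have indic0 k1 k2 (z : R * R) : (0 <= (w k1 k2 * \1_(I k1 `*` I k2) z)%:E)%E.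
  by rewrite lee_fin mulr_ge0// ltW.
under eq_integral => z _ do rewrite -sumEFin.
rewrite ge0_integral_sum//; last 2 first.
- move=> k1; under eq_fun do rewrite -sumEFin.
  by apply: emeasurable_sum => k2; exact: mindic.
- by move=> k1 z _; rewrite -sumEFin sume_ge0// => k2 _; exact: indic0.
apply: eq_bigr => k1 _.
under eq_integral => z _ do rewrite -sumEFin.
rewrite ge0_integral_sum//; last by move=> k2; exact: mindic.
apply: eq_bigr => k2 _.
under eq_integral => z _ do rewrite EFinM.
rewrite ge0_integralZl_EFin//; last 2 first.
- by apply/measurable_EFinP; apply: measurable_indic; exact: mC.
- exact: ltW.
rewrite integral_indic//; last exact: mC.
congr (_ * mu2 _)%E.
by rewrite -!IE; apply/seteqP; split => z /= => [[[]]|[[]]].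
Qed.

Section quantile_law.
Variables (R : realType) (n : nat) (v : nat -> R).
Hypotheses (n0 : (0 < n)%N) (v0 : forall k, 0 < v k).
Hypothesis vn : \sum_(k < n) v k = n%:R.

Let nN0 : n%:R != 0 :> R. Proof. by rewrite pnatr_eq0 -lt0n. Qed.

Lemma knot_full : knot n v n = 1.
Proof. by rewrite /knot vn divff. Qed.

(** Cut the square at the knots of the second coordinate. On the k-th piece the quantile function is
    affine with slope 1 / [v k] and maps onto the k-th cell, so areas of preimages gain the factor
    [v k]. *)
Lemma quantile_law (A : set (R * R)) : measurable A ->
  (mu2 (@unit_square R `&` (fun z => (z.1, quantile n v n z.2)) @^-1` A) =
  \sum_(k < n) (v k)%:E *
     mu2 (A `&` snd @^-1` `[(k%:R / n%:R)%R, (k.+1%:R / n%:R)%R]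
            `&` fst @^-1` `[0%R, 1%R]))%E.
Proof.
move=> mA.
set E := _ `&` _.
have mE : measurable E.
  apply: measurableI; first exact: measurable_unit_square.
  apply: measurable_preimage mA; apply: measurable_fun_pair => //.
  by apply: measurableT_comp => //; exact: measurable_quantile.
have := @sum_measure_slices _ (measurableTypeR R * measurableTypeR R)%type _ mu2
  _ _ n _ mE measurable_snd (@lebesgue2_snd_level R) (knot_leS n v0).
rewrite knot0 knot_full.
have -> : E `&` snd @^-1` `[0, 1] = E by apply/setIidPl => z [[]].
move=> <-; apply: eq_bigr => k _.
have vk := v0 k; have vN : v k != 0 by rewrite gt_eqF.
set P := _ `&` fst @^-1` _.
have mP : measurable P.
  by apply: measurableI; [apply: measurableI => //|]; exact: measurable_preimage.
have iv0 : (v k)^-1 != 0 by rewrite invr_eq0.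
(* The offset is that of the affine map which agrees with the quantile function on the k-th
   piece. *)
rewrite (lebesgue2_affine_preimage 0 (k%:R / n%:R - knot n v k / v k) (oner_neq0 R) iv0 mP).
rewrite muleA -EFinM mul1r gtr0_norm ?invr_gt0// divff// mul1e.
congr (mu2 _).
have kE t : affine (v k)^-1 (k%:R / n%:R - knot n v k / v k) t =
    k%:R / n%:R + (t - knot n v k) / v k.
  by rewrite /affine; ring.
have k1 : k.+1%:R / n%:R = k%:R / n%:R + n%:R^-1 :> R by rewrite -natr1 mulrDl mul1r.
have b0 : 0 <= knot n v k by rewrite -[leLHS](knot0 n v) knot_le.
have b1 : knot n v k.+1 <= 1 by rewrite -knot_full knot_le.
apply/seteqP; split => -[x t]; rewrite /E /P /affine2 /= !in_itv /= kE /affine mul1r addr0.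
  case=> -[/unit_squareP/= [x1 t1]] h tk.
  rewrite (quantile_on_piece n0 v0 (ltn_ord k) tk) in h; do 2 split => //.
  move: tk => /andP[kt tk].
  rewrite k1 lerDl lerD2l divr_ge0 ?subr_ge0//=; last exact: ltW.
  by rewrite ler_pdivrMr// lerBlDl mulrC -knotS.
case=> -[h]; rewrite k1 lerDl lerD2l pmulr_lge0 ?invr_gt0// subr_ge0.
rewrite (ler_pdivrMr _ _ vk) lerBlDl [n%:R^-1 * _]mulrC -knotS => tk x1.
split => //; split; first by apply/unit_squareP => /=; split => //; lra.
by rewrite (quantile_on_piece n0 v0 (ltn_ord k) tk).
Qed.

(** The weight depends on [k2] only, so it factors out of the sum over [k1] and the cells of a row
    merge into a full strip. *)
Lemma density_law_quantile (w : 'I_n -> 'I_n -> R) (A : set (R * R)) :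
  (forall k1 k2, w k1 k2 = v k2) -> measurable A ->
  density_law (cell_density w) A =
  mu2 (@unit_square R `&` (fun z => (z.1, quantile n v n z.2)) @^-1` A).
Proof.
move=> wv mA; rewrite density_lawE//; last by move=> k1 k2; rewrite wv.
rewrite quantile_law// exchange_big/=; apply: eq_bigr => k2 _.
under eq_bigr do rewrite wv.
rewrite -ge0_sume_distrr; last by move=> k1 _; exact: measure_ge0.
congr (_ * _)%E.
set B := A `&` _.
have mB : measurable B by apply: measurableI => //; exact: measurable_preimage.
have cS k : k%:R / n%:R <= k.+1%:R / n%:R :> R by rewrite ler_wpM2r ?ler_nat// invr_ge0.
have := @sum_measure_slices _ (measurableTypeR R * measurableTypeR R)%type _ mu2
  _ _ n _ mB measurable_fst (@lebesgue2_fst_level R) cS.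
by rewrite mul0r divff.
Qed.

End quantile_law.

(** * The coupling *)

Definition square_law (R : realType) : set (R * R) -> \bar R :=
  mrestr mu2 (@measurable_unit_square R).

Section square_law_probability.
Variable R : realType.

Let square_law0 : square_law (R := R) set0 = 0%E.
Proof. exact: measure0. Qed.

Let square_law_ge0 (A : set (R * R)) : (0 <= square_law A)%E.
Proof. exact: measure_ge0. Qed.

Let square_law_sigma_additive : semi_sigma_additive (@square_law R).
Proof. exact: (@measure_semi_sigma_additive _ (measurableTypeR R * measurableTypeR R)%type). Qed.

HB.instance Definition _ := isMeasure.Build _ _ _ (@square_law R)
  square_law0 square_law_ge0 square_law_sigma_additive.

Let square_lawT : square_law (R := R) setT = 1%E.
Proof.
rewrite /square_law /mrestr setTI /unit_square product_measure1E//.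
rewrite [X in (X * _)%E]lebesgue_measure_itv [X in (_ * X)%E]lebesgue_measure_itv.
by rewrite /= lte_fin ltr01 -EFinB subr0 mul1e.
Qed.

HB.instance Definition _ := Measure_isProbability.Build _ _ _ (@square_law R) square_lawT.

End square_law_probability.

Lemma measurable_tent (R : realType) : measurable_fun setT (@tent R).
Proof.
apply: measurable_funB; apply: measurable_funM => //; apply: measurable_maxr => //.
exact: measurable_funB.
Qed.

Lemma measurable_iter_tent (R : realType) s : measurable_fun setT (iter s (@tent R)).
Proof.
elim: s => [|s IH]; first exact: measurable_id.
exact: measurableT_comp (@measurable_tent R) IH.
Qed.

Lemma measurable_eucl_dist (R : realType) : measurable_fun setT (@eucl_dist R).
Proof.
apply: (measurableT_comp (continuous_measurable_fun (@sqrt_continuous R))).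
apply: measurable_funD; apply: measurable_funX; apply: measurable_funB => //;
  by do ![apply: measurableT_comp => //].
Qed.

(** The image of the uniform law under [G] is a coupling, whose cost is the mean of a function
    bounded by [c] on the square. *)
Lemma W1_le (R : realType) (mu nu : set (R * R) -> \bar R) (c : R)
    (G : R * R -> (R * R) * (R * R)) :
  measurable_fun setT G ->
  (forall A, measurable A -> square_law ((fst \o G) @^-1` A) = mu A) ->
  (forall A, measurable A -> square_law ((snd \o G) @^-1` A) = nu A) ->
  (forall z, unit_square z -> eucl_dist (G z) <= c) -> 0 <= c ->
  (W1 mu nu <= c%:E)%E.
Proof.
move=> mG muE nuE Gc c0.
pose GM := isMeasurableFun.Build _ _ _ _ _ mG.
pose GF : {mfun (R * R)%type >-> ((R * R) * (R * R))%type} := HB.pack G GM.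
pose pi : probability ((R * R) * (R * R))%type R := distribution (@square_law R) GF.
have piG : coupling mu nu pi.
  by move=> A mA; split; [exact: muE|exact: nuE].
have mE : measurable_fun setT (fun z => (eucl_dist z)%:E : \bar R).
  by apply/measurable_EFinP; exact: measurable_eucl_dist.
apply: (@le_trans _ _ (\int[pi]_z (eucl_dist z)%:E)%E).
  by apply: ereal_inf_lbound; exists pi.
rewrite /pi /distribution (ge0_integral_pushforward mG)//; last first.
  by move=> z _; rewrite lee_fin sqrtr_ge0.
rewrite preimage_setT.
apply: (@le_trans _ _ (\int[@square_law R]_z c%:E)%E); last first.
  by rewrite integral_cst// [X in (_ * X)%E]probability_setT mule1.
apply: ae_ge0_le_integral => //=.
- by move=> z _; rewrite lee_fin sqrtr_ge0.
- exact: measurableT_comp mE mG.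
(* The bound may fail only outside the square, which carries no mass. *)
exists (~` @unit_square R); split.
- by apply: measurableC; exact: measurable_unit_square.
- by rewrite /square_law /mrestr setICl measure0.
- move=> z /= h hz; apply: h => _; rewrite lee_fin; exact: Gc.
Qed.

Theorem mainTheorem7 (R : realType) (n s : nat) (w : 'I_n -> 'I_n -> R) :
  (0 < n)%N ->
  in_E2 w ->
  (forall k1 k1' k2 : 'I_n, w k1 k2 = w k1' k2) ->
  exists Phi : net R 1 2,
    (connectivity Phi <= 6 * n + 24 * s + 2)%N /\
    depth Phi = (s + 3)%N /\
    (W1 (pushU Phi) (density_law (cell_density w)) <=
       ((2 * Num.sqrt 2) / 2 ^+ s)%:E)%E.
Proof.
case: n w => // n w n0 [w0 wsum] wrow.
(* Out-of-range indices are sent to [ord0] by [inord], which keeps [v] positive on all of [nat]. *)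
pose v (k : nat) := w ord0 (inord k).
have v0 k : 0 < v k by exact: w0.
have wv k1 k2 : w k1 k2 = v k2 by rewrite /v inord_val; exact: wrow.
have vsum : \sum_(k < n.+1) v k = n.+1%:R.
  have nN0 : n.+1%:R != 0 :> R by rewrite pnatr_eq0.
  (* All n columns of cells have the same weight sum and together give n ^ 2; the factor n is
     cancelled. *)
  apply: (mulfI nN0); rewrite -natrM -[RHS]wsum mulr_natl.
  rewrite -[X in _ *+ X](card_ord n.+1) -sumr_const.
  by apply: eq_bigr => k1 _; apply: eq_bigr => k2 _; rewrite wv.
exists (curve_net n.+1 s v); split; first exact: curve_net_connectivity.
split; first exact: curve_net_depth.
pose Q := quantile n.+1 v n.+1.
have mQ : measurable_fun setT Q by exact: measurable_quantile.
pose G (z : R * R) := ((tent_branch s z.1 z.2, Q z.2), (z.1, Q z.2)).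
have mQ2 : measurable_fun setT (fun z : R * R => Q z.2) by exact: measurableT_comp.
have mG : measurable_fun setT G.
  apply: measurable_fun_pair; apply: measurable_fun_pair => //.
  exact: measurable_tent_branch.
(* The coupling costs at most 2 ^- s; the constant of the bound only has to be at least 1. *)
have ss : 1 <= 2 * Num.sqrt 2 :> R.
  have : 1 <= Num.sqrt 2 :> R by rewrite -[leLHS]sqrtr1 ler_wsqrtr ?ler1n.
  by lra.
apply: (W1_le mG) => [A mA|A mA|z /unit_squareP[x1 t1]|].
(* Since the iterated tent map sends the branch back to t, the first component of [G] is [C] at the
   branch, and the branch is uniform. *)
- pose C x := (x, Q (iter s (@tent R) x)).
  have mC : measurable_fun setT C.
    by apply: measurable_fun_pair => //; apply: measurableT_comp => //; exact: measurable_iter_tent.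
  have mCA : measurable (C @^-1` A) by exact: measurable_preimage.
  transitivity (lebesgue_measure (C @^-1` A `&` `[0, 1])).
    rewrite -(tent_branch_uniform s mCA) /square_law /mrestr setIC.
    congr (mu2 _); apply/seteqP; split => -[x t] /= [/unit_squareP/= [x1 t1] h].
      split; first exact/unit_squareP.
      by move: h; rewrite /C iter_tent_branch.
    split; first exact/unit_squareP.
    by move: h; rewrite /C iter_tent_branch.
  rewrite /pushU setIC; congr lebesgue_measure; apply/seteqP; split => x /=.
    rewrite in_itv /= => -[x1 h]; split => //.
    by rewrite net12_fun_curve_net//; case/andP: x1.
  move=> [x1 h]; split; first by rewrite in_itv.
  by move: h; rewrite net12_fun_curve_net//; case/andP: x1.
- by rewrite (density_law_quantile _ v0 vsum wv mA)// /square_law /mrestr setIC.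
(* The two points share their second coordinate, so only the horizontal gap remains. *)
- rewrite /eucl_dist /G /= subrr expr0n addr0 sqrtr_sqr.
  apply: le_trans (tent_branch_close s x1 t1) _.
  by rewrite ler_peMl// invr_ge0 exprn_ge0.
- by rewrite divr_ge0 ?exprn_ge0// (le_trans ler01).
Qed.
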